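(* Let $\alpha>0$ and $\delta>0$ be fixed real numbers with $\alpha+\delta\le \tfrac12$. Then $$\lim_{n\to\infty}\frac{\log \mathcal{R}_n(A^\ast(\delta,\alpha;n))}{n^{2\delta}}=-\frac18 .$$
   Context: For positive integers $n\le N$ and a real number $A\ge 0$, let $\Theta(A,n,N)$ be the set of matrices $\boldsymbol{\theta}=(\theta_{ij})\in\mathbb{R}^{N\times N}$ for which there exist $R,C\subset\{1,\dots,N\}$ with $|R|=|C|=n$ such that $\theta_{ij}\ge A$ for all $(i,j)\in R\times C$ and $\theta_{ij}=0$ for all other $(i,j)$. For $\boldsymbol{\theta}\in\mathbb{R}^{N\times N}$ let $\mathbb{P}_{\boldsymbol{\theta}}$ denote the law of a random matrix $\mathbf{X}=(X_{ij})_{1\le i,j\le N}$ with independent entries $X_{ij}\sim N(\theta_{ij},1)$, and let $\mathbb{P}_0$ be this law for $\boldsymbol{\theta}=\mathbf{0}$. A test is a measurable function $T=T(\mathbf{X})$ with values in $\{0,1\}$. The minimax risk is $$\mathcal{R}_{n,N}(A)=\inf_{T}\Big\{\mathbb{P}_0(T=1)+\sup_{\boldsymbol{\theta}\in\Theta(A,n,N)}\mathbb{P}_{\boldsymbol{\theta}}(T=0)\Big\},$$ the infimum being over all tests. For fixed $\alpha>0$ put $N=\lfloor n^{1+\alpha}\rfloor$ and $\mathcal{R}_n(A)=\mathcal{R}_{n,\lfloor n^{1+\alpha}\rfloor}(A)$. For $\delta\in(-1,\infty)$ define $$A^\ast(\delta,\alpha;n)=\min\Big\{n^{-(1-\alpha-\delta)},\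 \sqrt{\tfrac{4(1+\delta)\alpha\log n}{n}}\Big\}.$$ *)

(* Defs.v *)
From HB Require Import structures.
From mathcomp Require Import all_boot all_order all_algebra.
From mathcomp Require Import all_classical all_reals all_analysis.

Set Implicit Arguments.
Unset Strict Implicit.
Unset Printing Implicit Defensive.
Import Order.TTheory GRing.Theory Num.Theory.
Import numFieldNormedType.Exports.
Local Open Scope classical_set_scope.
Local Open Scope ring_scope.

(* The product sigma-algebra on matrices: the smallest one that makes every
   entry X |-> X i j measurable. *)
Section measurable_matrix.
Context {d : measure_display} {T : measurableType d}.
Variables m n : nat.

Definition mx_entry_preimages : set (set 'M[T]_(m, n)) :=
  [set A | exists i j, exists2 B : set T, measurable B &
             A = (fun X : 'M[T]_(m, n) => X i j) @^-1` B].

Definition mx_measurable : set (set 'M[T]_(m, n)) :=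
  <<s mx_entry_preimages >>.

Let mx_measurable0 : mx_measurable set0.
Proof. exact: sigma_algebra0. Qed.

Let mx_measurableC A : mx_measurable A -> mx_measurable (~` A).
Proof. exact: sigma_algebraC. Qed.

Let mx_measurable_bigcup (F : (set 'M[T]_(m, n))^nat) :
  (forall i, mx_measurable (F i)) -> mx_measurable (\bigcup_i F i).
Proof. exact: sigma_algebra_bigcup. Qed.

Definition measure_mx_display : measure_display -> measure_display.
Proof. exact. Qed.

HB.instance Definition _ := @isMeasurable.Build (measure_mx_display d)
  'M[T]_(m, n) mx_measurable mx_measurable0 mx_measurableC mx_measurable_bigcup.

End measurable_matrix.

Lemma measurable_fun_mxP d d' (U : measurableType d) (T : measurableType d')
    m n (f : U -> 'M[T]_(m, n)) :
  measurable_fun setT f <->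
  forall i j, measurable_fun setT (fun u => f u i j).
Proof.
split=> [mf i j _ B mB|mf].
  rewrite setTI -[X in measurable X]setTI.
  apply: (mf _ ((fun X : 'M[T]_(m, n) => X i j) @^-1` B)) => //.
  by apply: sub_sigma_algebra; exists i, j, B.
apply: (@measurability _ _ _ _ _ _ (@mx_entry_preimages _ T m n)) => //.
by move=> _ [_ [i [j [B mB ->]]] <-]; exact: (mf i j).
Qed.

Section tuple_product.
Context {d : measure_display} {T : measurableType d} {R : realType}.

Definition tcons n (p : T * n.-tuple T) : n.+1.-tuple T :=
  [tuple of p.1 :: p.2].

Lemma measurable_tcons n : measurable_fun setT (@tcons n).
Proof. exact: measurable_cons. Qed.

HB.instance Definition _ n := @isMeasurableFun.Build _ _ _ _ (@tcons n)
  (@measurable_tcons n).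

Fixpoint tuple_prod (n : nat) :
    ('I_n -> probability T R) -> probability (n.-tuple T) R :=
  match n with
  | 0 => fun _ => dirac [tuple]
  | n.+1 => fun P =>
      distribution
        (P ord0 \x tuple_prod (fun i => P (lift ord0 i)))%E (@tcons n)
  end.

Lemma tuple_prodE n (P : 'I_n -> probability T R) (B : 'I_n -> set T) :
  (forall i, measurable (B i)) ->
  tuple_prod P [set t | forall i, B i (tnth t i)] = (\prod_(i < n) P i (B i))%E.
Proof.
elim: n P B => [|n IH] P B mB.
  by rewrite /= big_ord0 diracE mem_set// => -[].
rewrite big_ord_recl -IH//=.
rewrite /distribution /pushforward.
set A := [set t : n.-tuple T | _].
have mA : measurable A.
  rewrite (_ : A = \bigcap_(i in [set: 'I_n])
      ((@tnth n T)^~ i @^-1` B (lift ord0 i))).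
    apply: fin_bigcap_measurable => // i _.
    by rewrite -[X in measurable X]setTI; exact: measurable_tnth.
  by apply/seteqP; split=> t /= h i; [move=> _; exact: h|exact: h].
rewrite -product_measure1E//; congr (_ _).
apply/seteqP; split=> -[x t] /=.
  move=> h; split; first by have := h ord0; rewrite tnth0.
  by move=> i; have := h (lift ord0 i); rewrite tnthS.
move=> [hx ht] i; case: (unliftP ord0 i) => [j ->|->].
  by rewrite tnthS; exact: ht.
by rewrite tnth0.
Qed.

End tuple_product.

Section gaussian_law.
Context {R : realType}.

Definition mx_of_tuple m n (t : (m * n).-tuple (measurableTypeR R)) : 'M[R]_(m, n) :=
  vec_mx (\row_k tnth t k).

Lemma measurable_mx_of_tuple m n : measurable_fun setT (@mx_of_tuple m n).
Proof.
apply/measurable_fun_mxP => i j.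
rewrite (_ : (fun _ => _) =
    (fun t : (m * n).-tuple (measurableTypeR R) => tnth t (mxvec_index i j))); last first.
  by apply/funext => t; rewrite !mxE.
exact: measurable_tnth.
Qed.

HB.instance Definition _ m n := @isMeasurableFun.Build _ _ _ _
  (@mx_of_tuple m n) (@measurable_mx_of_tuple m n).

Definition gaussian_law m n (theta : 'M[R]_(m, n)) :
    probability 'M[R]_(m, n) R :=
  distribution (tuple_prod (fun k => normal_prob (mxvec theta 0 k) 1))
    (@mx_of_tuple m n).

(* The entries are independent and the (i, j) entry is N(theta i j, 1). *)
Lemma gaussian_lawE m n (theta : 'M[R]_(m, n)) (B : 'I_m -> 'I_n -> set R) :
  (forall i j, measurable (B i j)) ->
  gaussian_law theta [set X | forall i j, B i j (X i j)]
  = (\prod_(i < m) \prod_(j < n) normal_prob (theta i j) 1 (B i j))%E.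
Proof.
move=> mB; rewrite /gaussian_law /distribution /pushforward.
pose B' (k : 'I_(m * n)) : set (measurableTypeR R) :=
  let p := enum_val (cast_ord (esym (mxvec_cast m n)) k) in B p.1 p.2.
have B'E i j : B' (mxvec_index i j) = B i j.
  by rewrite /B' /mxvec_index cast_ordK enum_rankK.
pose P k := normal_prob (mxvec theta 0 k) 1.
transitivity (tuple_prod P [set t | forall k, B' k (tnth t k)]).
  congr (tuple_prod _ _); apply/seteqP; split=> t /=.
    by move=> h k; case/mxvec_indexP: k => i j; rewrite B'E;
      have := h i j; rewrite !mxE.
  by move=> h i j; rewrite !mxE -B'E; exact: h.
rewrite tuple_prodE; last by move=> k; exact: mB.
rewrite pair_bigA/=.
rewrite (reindex (uncurry (@mxvec_index m n))) /=.
  by apply: eq_bigr => -[i j] _ /=; rewrite /P mxvecE B'E.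
exact: curry_mxvec_bij.
Qed.

End gaussian_law.

Section minimax.
Context {R : realType}.
Implicit Types (A alpha delta : R) (n N : nat).

Definition Theta (A : R) (n N : nat) : set 'M[R]_N :=
  [set theta : 'M[R]_N | exists I J : {set 'I_N}, [/\ #|I| = n, #|J| = n &
     forall i j, ((i \in I) && (j \in J) -> A <= theta i j) /\
                 (~~ ((i \in I) && (j \in J)) -> theta i j = 0)]].

Arguments Theta A n N _ : clear implicits.

Definition test N := {mfun 'M[R]_N >-> bool}.

(* [minimax_risk_ge0] and [minimax_risk_le1] show that for n <= N the value is
   a real number, so that [fine] below loses nothing. *)
Definition minimax_risk A n N : \bar R := ereal_inf (range (fun T : test N =>
  gaussian_law (0 : 'M[R]_N) [set X | T X = true]
  + ereal_sup [set gaussian_law theta [set X | T X = false]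
              | theta in Theta A n N]))%E.

Lemma Theta_const A n N : (n <= N)%N -> exists theta, Theta A n N theta.
Proof.
move=> nN; pose I := [set i : 'I_N | (i < n)%N]%SET.
have cI : #|I| = n.
  have winj : injective (widen_ord nN) by move=> i j [ij]; exact: val_inj.
  rewrite -[RHS]card_ord -(card_imset _ winj).
  apply: eq_card => i; rewrite inE; apply/idP/imsetP => [lti|[j _ ->]].
    by exists (Ordinal lti) => //; exact: val_inj.
  exact: (ltn_ord j).
exists (\matrix_(i, j) (if (i \in I) && (j \in I) then A else 0)).
exists I, I; split=> // i j; rewrite mxE.
by split=> [->//|/negbTE ->].
Qed.

Lemma minimax_risk_ge0 A n N : (n <= N)%N -> (0 <= minimax_risk A n N)%E.
Proof.
move=> nN; apply: le_ereal_inf_tmp => _ [T _ <-]; rewrite adde_ge0//.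
have [theta Htheta] := Theta_const A nN.
apply: (@le_trans _ _ (gaussian_law theta [set X | T X = false])) => //.
by apply: ereal_sup_ubound; exists theta.
Qed.

Lemma minimax_risk_le1 A n N : (minimax_risk A n N <= 1)%E.
Proof.
have cvT : measurable_fun setT (cst true : 'M[R]_N -> bool) by [].
pose T : test N := HB.pack (cst true : 'M[R]_N -> bool)
  (isMeasurableFun.Build _ _ _ _ _ cvT).
apply: ge_ereal_inf; eexists; first by exists T.
rewrite -[leRHS]adde0; apply: leeD.
  rewrite (_ : [set _ | _] = setT) ?probability_setT//.
  by apply/seteqP; split.
apply: ge_ereal_sup => _ [theta _ <-] /=.
by rewrite (_ : [set _ | _] = set0) ?measure0//; apply/seteqP; split.
Qed.

(* For a nonnegative argument [Num.truncn] is the floor. *)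
Definition ambient_size alpha n : nat := Num.truncn (n%:R `^ (1 + alpha)).

Definition risk alpha n A : R := fine (minimax_risk A n (ambient_size alpha n)).

Definition Astar delta alpha n : R :=
  Num.min (n%:R `^ (- (1 - alpha - delta)))
          (Num.sqrt (4 * (1 + delta) * alpha * ln n%:R / n%:R)).

End minimax.

Arguments Theta {R} A n N _.

(* Main.v *)
From HB Require Import structures.
Require Import Defs.
From mathcomp Require Import all_boot all_order all_algebra.
From mathcomp Require Import all_classical all_reals all_analysis.
From mathcomp Require Import measurable_realfun ring lra.
Set Implicit Arguments.
Unset Strict Implicit.
Unset Printing Implicit Defensive.
Import Order.TTheory GRing.Theory Num.Theory.
Import numFieldNormedType.Exports.
Local Open Scope classical_set_scope.
Local Open Scope ring_scope.

(** When alpha + delta <= 1/2 the minimum defining the signal level is, for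
large n, A = n^-(1 - alpha - delta).  Put m = n^2 A / N, which is n^delta up to
a factor tending to 1, and let v be the constant matrix with entries
n^2 A / N^2.  Then |v|^2 = m^2, and <v, theta> >= m^2 for every theta in the
alternative, with equality when all nonzero entries of theta are A.  The claim
is that the log-risk is -(1/8) m^2 up to o(m^2): the problem is as hard as
separating two unit Gaussians whose means are m apart.

Upper bound.  The test that compares <v, X> with m^2 / 2 has both errors at
most exp(-m^2 / 8) by Chernoff's inequality ([minimax_risk_upper]).

Lower bound.  The minimax risk dominates the Bayes risk of any prior on the
alternative, hence the integral of min(1, L) under the null law, L being the
likelihood ratio of the mixture ([bayes_risk_le]).  Under the null law L has an
exponentially large second moment, carried by the fluctuations of <v, X>, so
the mean is first moved to v / 2, halfway between the hypotheses, and
L' = L exp(-w) is considered, where w = <v, X> - m^2 / 2 is centred there and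
L' has mean 1 and does not correlate with w.  The bound
min(1, L) >= exp(-m^2 / 8 - |w| / 2) min(1, L') with respect to the moved law
produces the factor exp(-m^2 / 8); restricting to |w| <= eps m^2 costs
exp(-eps m^2 / 2), and the second moment of L', which is the prior average of
exp(<theta, theta'> - m^2), bounds E min(1, L') from below
([minimax_risk_lower]).  After the pointwise inequality
[truncated_likelihood_bound] every quantity is a linear combination of
exponentials of linear forms of X, whose Gaussian integrals are explicit.

Second moment.  Cut a set of n b indices, b = N / n rounded down, into n blocks
of length b and choose one row in each block and one column in each block,
uniformly and independently.  Two independent choices of rows agree in a
binomial number K of blocks, with parameters n and 1 / b, so the moment
generating function of the overlap is exact ([sum_expn_agree]) and
<theta, theta'> = A^2 K K', where K' counts the blocks in which the columns
agree.  Averaging over K' leaves the exponential of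
(n / b) (exp(A^2 K) - 1), which is linear in K to first order as long as
A^2 K <= eps.  As A^2 n <= 1, the other case forces K > eps n, which has
exponentially small probability because n / b is much smaller than n
([expR_overlap_bound]).  The average is therefore at most
exp((1 + o(1)) m^2), and the second moment of L' is exp(o(m^2)). *)

(** * Densities of Gaussian laws with respect to the centred one *)

Lemma measurable_weighted {d : measure_display} {T : measurableType d}
    {R : realType} (f : T -> \bar R) (g : T -> R) :
  measurable_fun setT f -> measurable_fun setT g ->
  measurable_fun setT (fun x => f x * (g x)%:E)%E.
Proof. by move=> mf mg; apply: emeasurable_funM => //; exact/measurable_EFinP. Qed.

(** The Radon-Nikodym change of variables is stated for an abstract derivative;
almost everywhere uniqueness of that derivative transfers it to a given
density. *)
Lemma ge0_integral_density {d : measure_display} {T : measurableType d}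
    {R : realType} (nu : {finite_measure set T -> \bar R})
    (mu : {sigma_finite_measure set T -> \bar R}) (g : T -> R) :
  measurable_fun setT g -> (forall x, 0 <= g x) ->
  (forall A, measurable A -> nu A = (\int[mu]_(x in A) (g x)%:E)%E) ->
  forall f : T -> \bar R, measurable_fun setT f -> (forall x, 0 <= f x)%E ->
  (\int[nu]_x f x = \int[mu]_x (f x * (g x)%:E))%E.
Proof.
move=> mg g0 nuE f mf f0.
have mgE : measurable_fun setT (EFin \o g) by exact/measurable_EFinP.
have numu : nu `<< mu.
  apply/null_content_dominatesP => A mA muA0; rewrite nuE//.
  by apply: null_set_integral => //; exact: measurable_funTS.
rewrite -(Radon_Nikodym_SigmaFinite.change_of_variables numu)//.
have mrn : measurable_fun setT (Radon_Nikodym_SigmaFinite.f nu mu).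
  exact: measurable_int (Radon_Nikodym_SigmaFinite.f_integrable numu).
apply: ae_eq_integral => //.
- exact: emeasurable_funM.
- exact: emeasurable_funM.
- apply: ae_eqe_mul2l => /=; apply: integral_ae_eq => //.
    exact: Radon_Nikodym_SigmaFinite.f_integrable.
  by move=> E _ mE; rewrite -Radon_Nikodym_SigmaFinite.f_integral// nuE.
Qed.

Section tuple_prod_recursion.
Context {d : measure_display} {T : measurableType d} {R : realType}.
Variables (n : nat) (P : 'I_n.+1 -> probability T R).
Variable f : n.+1.-tuple T -> \bar R.
Hypotheses (mf : measurable_fun setT f) (f0 : forall t, (0 <= f t)%E).

Let mf_tcons : measurable_fun setT (f \o @tcons _ T n).
Proof. by apply: measurableT_comp => //; exact: measurable_tcons. Qed.

Lemma ge0_integral_tuple_prodS :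
  (\int[tuple_prod P]_t f t =
   \int[P ord0]_x \int[tuple_prod (fun i => P (lift ord0 i))]_t
     f (tcons (x, t)))%E.
Proof.
transitivity (\int[(P ord0 \x tuple_prod (fun i => P (lift ord0 i)))%E]_p
    (f \o @tcons _ T n) p)%E; first exact: ge0_integral_distribution.
by rewrite (fubini_tonelli1 (f \o @tcons _ T n))// => -[x t]; exact: f0.
Qed.

Lemma measurable_integral_tcons :
  measurable_fun setT (fun x =>
    \int[tuple_prod (fun i => P (lift ord0 i))]_t f (tcons (x, t)))%E.
Proof.
apply: (measurable_fun_fubini_tonelli_F (f \o @tcons _ T n)) => // -[x t]; exact: f0.
Qed.

End tuple_prod_recursion.

Section gaussian_shift.
Context {R : realType}.

Lemma ge0_integral_normal_prob (a : R) (f : R -> \bar R) :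
  measurable_fun setT f -> (forall x, 0 <= f x)%E ->
  (\int[normal_prob a 1]_x f x =
   \int[lebesgue_measure]_x (f x * (normal_pdf a 1 x)%:E))%E.
Proof.
by apply: (@ge0_integral_density _ _ _ (normal_prob a 1) lebesgue_measure) => //;
  [exact: measurable_normal_pdf|exact: normal_pdf_ge0].
Qed.

Lemma measurable_shift_density (a : R) :
  measurable_fun setT (fun x : R => expR (a * x - a ^+ 2 / 2)).
Proof.
by apply: measurableT_comp => //; exact: measurable_funB.
Qed.

Lemma ge0_integral_normal_shift (a : R) (f : R -> \bar R) :
  measurable_fun setT f -> (forall x, 0 <= f x)%E ->
  (\int[normal_prob a 1]_x f x =
   \int[normal_prob 0 1]_x (f x * (expR (a * x - a ^+ 2 / 2))%:E))%E.
Proof.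
move=> mf f0; rewrite ge0_integral_normal_prob//.
rewrite [RHS]ge0_integral_normal_prob; last 2 first.
- exact: measurable_weighted mf (measurable_shift_density a).
- by move=> x; rewrite mule_ge0// lee_fin expR_ge0.
apply: eq_integral => x _; rewrite -muleA -EFinM; congr (_ * _%:E)%E.
rewrite !normal_pdfE// mulrCA; congr (_ * _).
rewrite /normal_fun -expRD; congr expR; by rewrite expr1n; field.
Qed.

Lemma measurable_sum_shift n (th : 'I_n -> R) :
  measurable_fun setT (fun t : n.-tuple (measurableTypeR R) =>
    expR (\sum_(k < n) (th k * tnth t k - th k ^+ 2 / 2))).
Proof.
apply: measurableT_comp => //; apply: measurable_sum => k.
apply: measurable_funB => //; apply: measurable_funM => //.
exact: measurable_tnth.
Qed.

(** The density of a product is the product of the densities; Tonelli's theorem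
peels off one coordinate at a time. *)
Lemma ge0_integral_tuple_shift n (th : 'I_n -> R)
    (f : n.-tuple (measurableTypeR R) -> \bar R) :
  measurable_fun setT f -> (forall t, 0 <= f t)%E ->
  (\int[tuple_prod (fun k => normal_prob (th k) 1)]_t f t =
   \int[tuple_prod (fun k => normal_prob 0 1)]_t
     (f t * (expR (\sum_(k < n) (th k * tnth t k - th k ^+ 2 / 2)))%:E))%E.
Proof.
elim: n th f => [|n IH] th f mf f0.
  by apply: eq_integral => t _; rewrite big_ord0 expR0 mule1.
pose e k (s : 'I_k -> R) (t : k.-tuple (measurableTypeR R)) :=
  expR (\sum_(i < k) (s i * tnth t i - s i ^+ 2 / 2)).
have me k s : measurable_fun setT (e k s) by exact: measurable_sum_shift.
pose th' (i : 'I_n) := th (lift ord0 i).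
have mfe : measurable_fun setT (fun t => f t * (e _ th t)%:E)%E.
  exact: measurable_weighted mf (me _ th).
have fe0 t : (0 <= f t * (e _ th t)%:E)%E.
  by rewrite mule_ge0// lee_fin expR_ge0.
have mfx x : measurable_fun setT (fun t => f (tcons (x, t))).
  apply: measurableT_comp => //.
  exact: measurableT_comp (@measurable_tcons _ _ n) _.
pose P k : probability (measurableTypeR R) R := normal_prob (th k) 1.
pose P0 (k : 'I_n.+1) : probability (measurableTypeR R) R := normal_prob 0 1.
transitivity (\int[P ord0]_x \int[tuple_prod (fun i => P (lift ord0 i))]_t
    f (tcons (x, t)))%E; first exact: (ge0_integral_tuple_prodS P mf f0).
transitivity (\int[P0 ord0]_x \int[tuple_prod (fun i => P0 (lift ord0 i))]_t
    (f (tcons (x, t)) * (e _ th (tcons (x, t)))%:E))%E; last first.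
  exact/esym/(ge0_integral_tuple_prodS P0 mfe fe0).
transitivity (\int[P0 ord0]_x
    (\int[tuple_prod (fun i => P (lift ord0 i))]_t f (tcons (x, t)) *
     (expR (th ord0 * x - th ord0 ^+ 2 / 2))%:E))%E.
  apply: ge0_integral_normal_shift; first exact: (measurable_integral_tcons P mf f0).
  by move=> x; exact: integral_ge0.
apply: eq_integral => x _; rewrite [in LHS]IH//.
rewrite muleC -ge0_integralZl//; last 2 first.
- exact: (measurable_weighted (mfx x) (me n th')).
- by move=> t _; rewrite mule_ge0// lee_fin expR_ge0.
apply: eq_integral => t _; rewrite muleCA -EFinM -expRD /e big_ord_recl tnth0.
congr (_ * (expR (_ + _))%:E)%E.
by apply: eq_bigr => i _; rewrite tnthS.
Qed.

End gaussian_shift.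

(** * Exponentials of linear forms on matrices *)

Section matrix_dot_product.
Context {R : realType} {m n : nat}.
Implicit Types A B C : 'M[R]_(m, n).

Definition mxdot A B : R := \sum_i \sum_j A i j * B i j.

Lemma mxdotC A B : mxdot A B = mxdot B A.
Proof. by do 2 (apply: eq_bigr => ? _); rewrite mulrC. Qed.

Lemma mxdotDl A B C : mxdot (A + B) C = mxdot A C + mxdot B C.
Proof.
rewrite /mxdot -big_split; apply: eq_bigr => i _; rewrite -big_split.
by apply: eq_bigr => j _; rewrite !mxE mulrDl.
Qed.

Lemma mxdotZl a A B : mxdot (a *: A) B = a * mxdot A B.
Proof.
rewrite /mxdot mulr_sumr; apply: eq_bigr => i _; rewrite mulr_sumr.
by apply: eq_bigr => j _; rewrite !mxE mulrA.
Qed.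

Lemma mxdotDr A B C : mxdot C (A + B) = mxdot C A + mxdot C B.
Proof. by rewrite mxdotC mxdotDl mxdotC [mxdot B C]mxdotC. Qed.

Lemma mxdotZr a A B : mxdot A (a *: B) = a * mxdot A B.
Proof. by rewrite mxdotC mxdotZl mxdotC. Qed.

Definition mxdotE := (mxdotDl, mxdotDr, mxdotZl, mxdotZr).

Lemma mxdot_ge0 A : 0 <= mxdot A A.
Proof. by do 2 (apply: sumr_ge0 => ? _); rewrite -expr2 sqr_ge0. Qed.

Lemma measurable_mxdot A : measurable_fun setT (mxdot A).
Proof.
apply: measurable_sum => i; apply: measurable_sum => j.
apply: measurable_funM => //.
by have /measurable_fun_mxP := @measurable_id _ 'M[R]_(m, n) setT; exact.
Qed.

Lemma measurable_expR_mxdot A c :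
  measurable_fun setT (fun X => expR (mxdot A X + c)).
Proof.
by apply: measurableT_comp => //; apply: measurable_funD => //;
  exact: measurable_mxdot.
Qed.

Lemma ge0_integral_gaussian_law theta (f : 'M[R]_(m, n) -> \bar R) :
  measurable_fun setT f -> (forall X, 0 <= f X)%E ->
  (\int[gaussian_law theta]_X f X =
   \int[gaussian_law 0]_X
     (f X * (expR (mxdot theta X - mxdot theta theta / 2))%:E))%E.
Proof.
move=> mf f0.
pose P (th : 'M[R]_(m, n)) k : probability (measurableTypeR R) R :=
  normal_prob (mxvec th 0 k) 1.
have P0 : P 0 = fun=> normal_prob 0 1.
  by apply/funext => k; rewrite /P linear0 mxE.
pose g X := (f X * (expR (mxdot theta X - mxdot theta theta / 2))%:E)%E.
have mg : measurable_fun setT g.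
  exact: measurable_weighted mf (measurable_expR_mxdot _ _).
have g0 X : (0 <= g X)%E by rewrite mule_ge0// lee_fin expR_ge0.
transitivity (\int[tuple_prod (P theta)]_t (f \o @mx_of_tuple R m n) t)%E.
  exact: ge0_integral_distribution.
transitivity (\int[tuple_prod (P 0%R)]_t (g \o @mx_of_tuple R m n) t)%E; last first.
  exact/esym/ge0_integral_distribution.
rewrite P0; apply: etrans.
  apply: (@ge0_integral_tuple_shift _ _ (fun k => mxvec theta 0 k)
    (f \o @mx_of_tuple R m n)).
  - exact: measurableT_comp.
  - by move=> t; exact: f0.
apply: eq_integral => t _ /=; congr (_ * (expR _)%:E)%E.
rewrite (reindex (uncurry (@mxvec_index m n))) /=; last exact: curry_mxvec_bij.
rewrite /mxdot mulr_suml -sumrB; under [RHS]eq_bigr do rewrite mulr_suml -sumrB.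
rewrite [RHS]pair_bigA/=; apply: eq_bigr => -[i j] _ /=.
by rewrite mxvecE !mxE -expr2.
Qed.

(** This Gaussian moment generating function says that the density of the law
with mean A has total mass 1. *)
Lemma integral_expR_mxdot A c :
  (\int[gaussian_law 0]_X (expR (mxdot A X + c))%:E =
   (expR (mxdot A A / 2 + c))%:E)%E.
Proof.
pose d := expR (mxdot A A / 2 + c).
have d0 : 0 <= d by exact: expR_ge0.
transitivity (\int[gaussian_law A]_X (cst d%:E X))%E.
  apply: etrans; last apply/esym/(@ge0_integral_gaussian_law A (cst d%:E)) => //.
  apply: eq_integral => X _.
  by rewrite -EFinM -expRD; congr (expR _)%:E; lra.
by rewrite integral_cst//= [X in (_ * X)%E]probability_setT mule1.
Qed.

(** Likelihood ratios of finite mixtures, their tilts and their squares all have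
this form, so that a single integral formula serves for all of them. *)
Definition expsum (I : finType) (p : R) (a : I -> 'M[R]_(m, n)) (c : I -> R)
    (X : 'M[R]_(m, n)) : R :=
  p * \sum_i expR (mxdot (a i) X + c i).

Lemma expsum_ge0 (I : finType) p (a : I -> 'M[R]_(m, n)) c X :
  0 <= p -> 0 <= expsum p a c X.
Proof. by move=> p0; rewrite mulr_ge0// sumr_ge0// => i _; exact: expR_ge0. Qed.

Lemma measurable_expsum (I : finType) p (a : I -> 'M[R]_(m, n)) c :
  measurable_fun setT (expsum p a c).
Proof.
apply: measurable_funM => //; apply: measurable_sum => i.
exact: measurable_expR_mxdot.
Qed.

Lemma expsum_shift (I : finType) p (a : I -> 'M[R]_(m, n)) c b d X :
  expsum p (fun i => a i + b) (fun i => c i + d) X =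
  expsum p a c X * expR (mxdot b X + d).
Proof.
rewrite /expsum -mulrA mulr_suml; congr (_ * _); apply: eq_bigr => i _.
by rewrite mxdotDl -expRD; congr expR; lra.
Qed.

Lemma expsumM (I J : finType) p q (a : I -> 'M[R]_(m, n)) c
    (b : J -> 'M[R]_(m, n)) d X :
  expsum p a c X * expsum q b d X =
  expsum (p * q) (fun ij => a ij.1 + b ij.2) (fun ij => c ij.1 + d ij.2) X.
Proof.
rewrite /expsum mulrACA; congr (_ * _); rewrite big_distrlr pair_bigA/=.
by apply: eq_bigr => -[i j] _ /=; rewrite mxdotDl -expRD; congr expR; lra.
Qed.

Lemma integral_expsum (I : finType) p (a : I -> 'M[R]_(m, n)) c : 0 <= p ->
  (\int[gaussian_law 0]_X (expsum p a c X)%:E =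
   (p * \sum_i expR (mxdot (a i) (a i) / 2 + c i))%:E)%E.
Proof.
move=> p0; under eq_integral do rewrite /expsum EFinM -sumEFin.
rewrite ge0_integralZl//; last 2 first.
- by apply: emeasurable_sum => i; apply/measurable_EFinP;
    exact: measurable_expR_mxdot.
- by move=> X _; apply: sume_ge0 => i _; rewrite lee_fin expR_ge0.
rewrite ge0_integral_sum//; last first.
  by move=> i; apply/measurable_EFinP; exact: measurable_expR_mxdot.
by rewrite EFinM -sumEFin; congr (_ * _)%E; apply: eq_bigr => i _;
  exact: integral_expR_mxdot.
Qed.

End matrix_dot_product.

Lemma gaussian_law_density {R : realType} {m n : nat} (theta : 'M[R]_(m, n)) S :
  measurable S ->
  gaussian_law theta S =
  (\int[gaussian_law 0]_X
    (\1_S X * expR (mxdot theta X - mxdot theta theta / 2))%:E)%E.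
Proof.
move=> mS; transitivity (\int[gaussian_law theta]_X (\1_S X)%:E)%E.
  by apply/esym; apply: etrans; [exact: integral_indic|rewrite setIT].
apply: (@ge0_integral_gaussian_law _ _ _ theta (EFin \o \1_S)) => //.
  exact/measurable_EFinP.
by move=> X; rewrite lee_fin.
Qed.

(** * The linear test *)

Section risk_bounds.
Context {R : realType}.

(** Chernoff's inequality: the indicator of S is at most the exponential of the
linear form that is nonnegative on S. *)
Lemma gaussian_law_chernoff m n (theta b : 'M[R]_(m, n)) c S :
  measurable S -> (forall X, S X -> 0 <= mxdot b X + c) ->
  (gaussian_law theta S <=
   (expR (mxdot b b / 2 + mxdot theta b + c))%:E)%E.
Proof.
move=> mS Sb; rewrite gaussian_law_density//.
apply: (@le_trans _ _ (\int[gaussian_law 0]_X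
  (expR (mxdot (theta + b) X + (c - mxdot theta theta / 2)))%:E)%E).
  apply: ge0_le_integral => //.
  - apply/measurable_EFinP; apply: measurable_funM => //.
    exact: measurable_expR_mxdot.
  - by apply/measurable_EFinP; exact: measurable_expR_mxdot.
  move=> X _; rewrite lee_fin indicE.
  have [/set_mem/Sb bX|_] := boolP (X \in S); last by rewrite mul0r expR_ge0.
  by rewrite mul1r ler_expR mxdotDl; lra.
rewrite integral_expR_mxdot lee_fin ler_expR !mxdotE (mxdotC b theta).
lra.
Qed.

(** The threshold half-way between 0 and |v|^2 balances the two errors, each
being bounded with the tilt v / 2 towards the other hypothesis. *)
Lemma minimax_risk_upper A n N (v : 'M[R]_N) :
  (forall theta, Theta A n N theta -> mxdot v v <= mxdot v theta) ->
  (minimax_risk A n N <= (2 * expR (- (mxdot v v / 8)))%:E)%E.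
Proof.
move=> vTheta; set s := mxdot v v.
have mf : measurable_fun setT (fun X => s / 2 <= mxdot v X).
  by apply: measurable_fun_ler => //; exact: measurable_mxdot.
pose T : test N := HB.pack (fun X => s / 2 <= mxdot v X)
  (isMeasurableFun.Build _ _ _ _ _ mf).
have mT b : measurable [set X | T X = b].
  by rewrite -[X in measurable X]setTI; exact: (mf measurableT [set b]).
apply: ge_ereal_inf; eexists; first by exists T.
rewrite (_ : 2 * _ = expR (- (s / 8)) + expR (- (s / 8))); last by ring.
rewrite EFinD; apply: leeD.
  apply: le_trans (@gaussian_law_chernoff _ _ 0 (2^-1 *: v) (- (s / 4)) _ _ _) _ => //.
    by move=> X /= sX; rewrite mxdotZl; lra.
  rewrite lee_fin ler_expR !mxdotE -/s (_ : mxdot 0 v = 0); first by lra.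
  by rewrite -(scale0r v) mxdotZl mul0r.
apply: ge_ereal_sup => _ [theta /vTheta vth <-] /=.
apply: le_trans (@gaussian_law_chernoff _ _ theta (- 2^-1 *: v) (s / 4) _ _ _) _ => //.
  by move=> X /= /negbT; rewrite -ltNge mxdotZl; lra.
by rewrite lee_fin ler_expR !mxdotE mxdotC -/s; move: vth; rewrite -/s; lra.
Qed.

End risk_bounds.

(** * A lower bound from the second moment of a mixture *)

(** With l = L exp(-w) this bounds min(1, L) below by terms with explicit
integrals.  On |w| <= eps s the exponential prefactor is at most
min(1, exp w), and c l - (c l / 2)^2 is at most 1 by completing the square, and
at most l as c <= 1.  Off that event the left-hand side is nonpositive, since
exp(eps w) + exp(- eps w) then exceeds exp(eps^2 s); this replaces the indicator
of the event by exponentials. *)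
Lemma truncated_likelihood_bound (R : realType) (l w s eps c : R) :
  0 <= l -> 0 <= s -> 0 < eps -> 0 < c -> c <= 1 ->
  expR (w / 2 - eps * s / 2) *
    (c * l * (1 - expR (- (eps ^+ 2 * s)) * (expR (eps * w) + expR (- (eps * w))))
     - c ^+ 2 / 4 * l ^+ 2) <=
  Num.min 1 (l * expR w).
Proof.
move=> l0 s0 e0 c0 c1; set I := (X in _ * X).
have [sw|] := lerP `|w| (eps * s).
  have := sw; rewrite ler_norml => /andP[w1 w2].
  have E1 : expR (w / 2 - eps * s / 2) <= 1 by rewrite expR_le1; lra.
  have E2 : expR (w / 2 - eps * s / 2) <= expR w by rewrite ler_expR; lra.
  have E0 := expR_ge0 (w / 2 - eps * s / 2).
  have [I0|I0] := lerP I 0.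
    apply: (@le_trans _ _ 0); first by rewrite mulr_ge0_le0.
    by rewrite le_min ler01 mulr_ge0// expR_ge0.
  have II : I <= c * l - c ^+ 2 / 4 * l ^+ 2.
    have cl0 : 0 <= c * l by rewrite mulr_ge0// ltW.
    by rewrite /I lerD2r ler_piMr// gerBl.
  have I1 : I <= 1.
    by apply: (le_trans II); have := sqr_ge0 (c * l / 2 - 1); lra.
  have Il : I <= l.
    apply: (le_trans II); rewrite -[leRHS]subr0 lerB//.
      by rewrite ler_piMl.
    by rewrite mulr_ge0 ?sqr_ge0// mulr_ge0 ?sqr_ge0.
  rewrite le_min; apply/andP; split.
    by rewrite mulr_ile1// ltW.
  by rewrite mulrC ler_pM// ltW.
move=> sw; apply: (@le_trans _ _ 0); last first.
  by rewrite le_min ler01 mulr_ge0// expR_ge0.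
rewrite mulr_ge0_le0 ?expR_ge0// subr_le0.
apply: (@le_trans _ _ 0); last first.
  by rewrite mulr_ge0 ?sqr_ge0// mulr_ge0 ?sqr_ge0.
rewrite mulr_ge0_le0 ?mulr_ge0 ?(ltW c0)// subr_le0.
rewrite mulrDr -!expRD.
have ew : eps ^+ 2 * s <= eps * `|w| by rewrite expr2 -mulrA ler_pM2l// ltW.
have [w0|w0] := lerP 0 w.
  rewrite ger0_norm// in ew; rewrite -[leLHS]addr0 lerD ?expR_ge0//.
  by rewrite -[leLHS]expR0 ler_expR; lra.
rewrite ltr0_norm// in ew; rewrite -[leLHS]add0r lerD ?expR_ge0//.
by rewrite -[leLHS]expR0 ler_expR; lra.
Qed.

Section bayes_risk.
Context {R : realType}.
Variables (N : nat) (K : finType) (th : K -> 'M[R]_N).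
Hypothesis K0 : (0 < #|K|)%N.
Implicit Type v : 'M[R]_N.

Let p : R := #|K|%:R^-1.
Let p0 : 0 <= p. Proof. by rewrite invr_ge0. Qed.
Let p1 : p * #|K|%:R = 1.
Proof. by rewrite mulVf// pnatr_eq0 -lt0n. Qed.

Let likelihood := expsum p th (fun k => - (mxdot (th k) (th k) / 2)).

(** The worst case over the alternative dominates the average over the prior,
and averaging the laws averages their densities. *)
Lemma bayes_risk_le A n (S0 S1 : set 'M[R]_N) :
  (forall k, Theta A n N (th k)) -> measurable S0 -> measurable S1 ->
  (\int[gaussian_law (0 : 'M[R]_N)]_X (\1_S1 X + \1_S0 X * likelihood X)%:E <=
   gaussian_law 0 S1 +
   ereal_sup [set gaussian_law theta S0 | theta in Theta A n N])%E.
Proof.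
move=> thK mS0 mS1; under eq_integral do rewrite EFinD.
have mL : measurable_fun setT (fun X => \1_S0 X * likelihood X).
  by apply: measurable_funM => //; exact: measurable_expsum.
have L0 X : 0 <= \1_S0 X * likelihood X.
  by rewrite mulr_ge0// expsum_ge0.
rewrite ge0_integralD//; last 3 first.
- exact/measurable_EFinP.
- by move=> X _; rewrite lee_fin.
- exact/measurable_EFinP.
apply: leeD; first by rewrite integral_indic// setIT.
set B := ereal_sup _.
have PB k : (gaussian_law (th k) S0 <= B)%E.
  by apply: ereal_sup_ubound; exists (th k).
have [k0 _] : exists k : K, true by move/card_gt0P: K0 => [k _]; exists k.
have B0 : (0 <= B)%E by apply: le_trans (PB k0); exact: measure_ge0.
have B1 : (B <= 1)%E.
  by apply: ge_ereal_sup => _ [theta _ <-]; exact: probability_le1.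
have Bfin : B \is a fin_num.
  by rewrite ge0_fin_numE// (le_lt_trans B1)// ltry.
rewrite -(fineK Bfin).
have -> : (\int[gaussian_law (0 : 'M[R]_N)]_X (\1_S0 X * likelihood X)%:E =
    p%:E * \sum_k gaussian_law (th k) S0)%E.
  rewrite (eq_integral (fun X => p%:E * \sum_k
      (\1_S0 X * expR (mxdot (th k) X - mxdot (th k) (th k) / 2))%:E)%E); last first.
    move=> X _; rewrite sumEFin -EFinM -mulr_sumr; congr _%:E.
    by rewrite /likelihood /expsum mulrCA.
  have mk k : measurable_fun setT (fun X : 'M[R]_N =>
      (\1_S0 X * expR (mxdot (th k) X - mxdot (th k) (th k) / 2))%:E).
    apply/measurable_EFinP; apply: measurable_funM => //.
    exact: measurable_expR_mxdot.
  have k_ge0 k X :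
      (0 <= (\1_S0 X * expR (mxdot (th k) X - mxdot (th k) (th k) / 2))%:E)%E.
    by rewrite lee_fin mulr_ge0// expR_ge0.
  rewrite ge0_integralZl//; last 2 first.
  - exact: emeasurable_sum.
  - by move=> X _; apply: sume_ge0.
  rewrite ge0_integral_sum//; congr (_ * _)%E; apply: eq_bigr => k _.
  by rewrite gaussian_law_density.
apply: (@le_trans _ _ (p%:E * \sum_(k : K) (fine B)%:E)%E).
  by rewrite lee_wpmul2l// lee_sum// => k _; rewrite fineK.
by rewrite sumEFin -EFinM lee_fin sumr_const -mulr_natr mulrCA p1 mulr1.
Qed.

(** Here |v|^2 = s plays the role of m^2.  The orthogonality of v and
th k - v, which the assumption on the scalar products expresses, makes the tilted
mixture density have mean 1 whatever multiple of v the mean of X is moved by;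
its second moment under such a law is the average bounded by M. *)
Lemma minimax_risk_lower A n v (M eps : R) :
  (forall k, Theta A n N (th k)) ->
  (forall k, mxdot v (th k) = mxdot v v) ->
  1 <= M ->
  p ^+ 2 * \sum_kl expR (mxdot (th kl.1) (th kl.2) - mxdot v v) <= M ->
  0 < eps -> expR (- (eps ^+ 2 * mxdot v v / 2)) <= 1 / 4 ->
  ((expR (- (1 + 4 * eps) * (mxdot v v / 8)) / (4 * M))%:E <=
   minimax_risk A n N)%E.
Proof.
move=> thK; set s := mxdot v v => vth M1 HM eps0 He.
apply: le_ereal_inf_tmp => _ [T _ <-].
have mT b : measurable [set X | T X = b].
  by rewrite -[X in measurable X]setTI; exact: (measurable_funP T measurableT [set b]).
set S1 := [set X | T X = true]; set S0 := [set X | T X = false].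
apply: le_trans; last exact: (bayes_risk_le thK (mT false) (mT true)).
rewrite -/S1 -/S0.
have s0 : 0 <= s by exact: mxdot_ge0.
have M0 : 0 < M by exact: lt_le_trans M1.
(* What is left of exp(- s / 8 - |w| / 2) when |w| = eps * s. *)
pose kap := expR (- (s / 8) - eps * s / 2).
have kap0 : 0 <= kap by exact: expR_ge0.
(* This choice maximizes c / 2 - c ^+ 2 * M / 4. *)
pose c := M^-1.
have c0 : 0 < c by rewrite invr_gt0.
have c1 : c <= 1 by rewrite invf_le1.
pose e := expR (- (eps ^+ 2 * s)).
have e0 : 0 <= e by exact: expR_ge0.
pose cth k := - (mxdot (th k) (th k) / 2).
(* Up to the factor a, these are the integrands L' exp(r w) and L' ^ 2,
   multiplied by the density of the law with mean v / 2. *)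
pose U a r := expsum (a * p) (fun k => th k + (r - 1 / 2) *: v)
  (fun k => cth k + (3 * s / 8 - r * s / 2)).
pose Q a := expsum (a * (p * p)) (fun kl => th kl.1 + th kl.2 + - (3 / 2) *: v)
  (fun kl => cth kl.1 + cth kl.2 + 7 * s / 8).
have UE a r X : U a r X =
    a * likelihood X * expR (- (mxdot v X - s / 2) / 2 + s / 8 +
                            r * (mxdot v X - s / 2)).
  rewrite /U expsum_shift /likelihood /expsum mxdotZl !mulrA.
  by congr (_ * expR _); lra.
have QE a X : Q a X =
    a * likelihood X ^+ 2 * expR (- 3 * (mxdot v X - s / 2) / 2 + s / 8).
  rewrite /Q expsum_shift /likelihood expr2 expsumM /expsum mxdotZl !mulrA.
  by congr (_ * expR _); lra.
have intU a r : 0 <= a ->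
    (\int[gaussian_law (0 : 'M[R]_N)]_X (U a r X)%:E =
     (a * expR (r ^+ 2 * s / 2))%:E)%E.
  move=> a0; rewrite integral_expsum ?mulr_ge0//; congr _%:E.
  rewrite (eq_bigr (fun=> expR (r ^+ 2 * s / 2))); last first.
    move=> k _; congr expR.
    by rewrite !mxdotE (mxdotC (th k) v) vth -/s /cth; lra.
  by rewrite sumr_const -[_ *+ #|_|]mulr_natl mulrA -(mulrA a) p1 mulr1.
have intQ a : 0 <= a ->
    (\int[gaussian_law (0 : 'M[R]_N)]_X (Q a X)%:E =
     (a * (p ^+ 2 * \sum_kl expR (mxdot (th kl.1) (th kl.2) - s)))%:E)%E.
  move=> a0; rewrite integral_expsum ?mulr_ge0//; congr _%:E.
  rewrite [RHS]mulrA expr2; congr (_ * _); apply: eq_bigr => -[k l] _ /=.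
  congr expR; rewrite !mxdotE !(mxdotC _ v) !vth -/s /cth.
  by rewrite (mxdotC (th l) (th k)); lra.
have U_ge0 a r X : 0 <= a -> 0 <= U a r X.
  by move=> a0; rewrite expsum_ge0// mulr_ge0.
have Q_ge0 a X : 0 <= a -> 0 <= Q a X.
  by move=> a0; rewrite expsum_ge0// !mulr_ge0.
have mU a r : measurable_fun setT (U a r) by exact: measurable_expsum.
have mQ a : measurable_fun setT (Q a) by exact: measurable_expsum.
pose a1 := kap * c * e; pose a2 := kap * (c ^+ 2 / 4).
have a10 : 0 <= a1 by rewrite !mulr_ge0// ltW.
have a20 : 0 <= a2 by rewrite !mulr_ge0// ltW.
have kc0 : 0 <= kap * c by rewrite mulr_ge0// ltW.
pose B X := \1_S1 X + \1_S0 X * likelihood X.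
have L0 X : 0 <= likelihood X by exact: expsum_ge0.
have BL X : Num.min 1 (likelihood X) <= B X.
  rewrite /B !indicE; case TX : (T X).
    by rewrite mem_set//= ge_min lerDl mulr_ge0.
  rewrite [X \in S0]mem_set//= mul1r [X \in S1]memNset ?add0r; last first.
    by rewrite /S1/= TX.
  by rewrite ge_min lexx orbT.
have B0 X : 0 <= B X by apply: le_trans (BL X); rewrite le_min ler01 L0.
have mB : measurable_fun setT B.
  have mS1 : measurable S1 by exact: mT.
  have mS0 : measurable S0 by exact: mT.
  apply: measurable_funD => //; apply: measurable_funM => //.
  exact: measurable_expsum.
have pointwise X : U (kap * c) 0 X <=
    B X + (U a1 eps X + (U a1 (- eps) X + Q a2 X)).
  rewrite -lerBlDr; apply: le_trans (BL X).
  set w := mxdot v X - s / 2.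
  have wL : 0 <= likelihood X * expR (- w) by rewrite mulr_ge0 ?expR_ge0.
  have := truncated_likelihood_bound w wL s0 eps0 c0 c1.
  rewrite -[_ * expR w]mulrA -expRD addNr expR0 mulr1.
  apply: le_trans; rewrite !UE QE -/w le_eqVlt; apply/orP; left; apply/eqP.
  set x1 := expR (w / 2 - _); set x2 := expR (- w); rewrite -/e.
  have F0 : kap * expR (- w / 2 + s / 8 + 0 * w) = x1 * x2.
    by rewrite -!expRD; congr expR; lra.
  have F1 : kap * expR (- w / 2 + s / 8 + eps * w) = x1 * x2 * expR (eps * w).
    by rewrite -!expRD; congr expR; lra.
  have F2 : kap * expR (- w / 2 + s / 8 + - eps * w) =
      x1 * x2 * expR (- (eps * w)).
    by rewrite -!expRD; congr expR; lra.
  have F3 : kap * expR (- 3 * w / 2 + s / 8) = x1 * x2 ^+ 2.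
    by rewrite expr2 -!expRD; congr expR; lra.
  set L := likelihood X.
  transitivity (c * L * (x1 * x2) - (c * e * L * (x1 * x2 * expR (eps * w)) +
    (c * e * L * (x1 * x2 * expR (- (eps * w))) +
     c ^+ 2 / 4 * L ^+ 2 * (x1 * x2 ^+ 2)))).
    by rewrite -F1 -F2 -F3 -F0 /a1 /a2; ring.
  by ring.
have m3 : measurable_fun setT (fun X => U a1 (- eps) X + Q a2 X).
  exact: measurable_funD.
have m2 : measurable_fun setT (fun X => U a1 eps X + (U a1 (- eps) X + Q a2 X)).
  exact: measurable_funD.
have h3 X : 0 <= U a1 (- eps) X + Q a2 X by rewrite addr_ge0 ?U_ge0 ?Q_ge0.
have h2 X : 0 <= U a1 eps X + (U a1 (- eps) X + Q a2 X).
  by rewrite addr_ge0 ?U_ge0.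
have intD (f g : 'M[R]_N -> R) : (forall X, 0 <= f X) -> (forall X, 0 <= g X) ->
    measurable_fun setT f -> measurable_fun setT g ->
    (\int[gaussian_law (0 : 'M[R]_N)]_X (f X + g X)%:E =
     \int[gaussian_law (0 : 'M[R]_N)]_X (f X)%:E +
     \int[gaussian_law (0 : 'M[R]_N)]_X (g X)%:E)%E.
  move=> f0 g0 /measurable_EFinP mf /measurable_EFinP mg.
  under eq_integral do rewrite EFinD.
  by apply: ge0_integralD => // X _; rewrite lee_fin.
have : (\int[gaussian_law (0 : 'M[R]_N)]_X (U (kap * c) 0 X)%:E <=
    \int[gaussian_law (0 : 'M[R]_N)]_X
      (B X + (U a1 eps X + (U a1 (- eps) X + Q a2 X)))%:E)%E.
  apply: ge0_le_integral => //.
  - by move=> X _; rewrite lee_fin U_ge0.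
  - by apply/measurable_EFinP; exact: mU.
  - by apply/measurable_EFinP; exact: measurable_funD.
  - by move=> X _; rewrite lee_fin.
have Um0 X : 0 <= U a1 (- eps) X by exact: U_ge0.
have Up0 X : 0 <= U a1 eps X by exact: U_ge0.
have Q0 X : 0 <= Q a2 X by exact: Q_ge0.
rewrite (intD _ _ B0 h2 mB m2) (intD _ _ Up0 h3 (mU _ _) m3).
rewrite (intD _ _ Um0 Q0 (mU _ _) (mQ _)).
rewrite !intU// intQ// -!EFinD.
set J := (\int[_]_X (B X)%:E)%E.
rewrite -leeBlDr// -EFinB => HJ; apply: le_trans HJ; rewrite lee_fin.
set S := (p ^+ 2 * _) in HM *.
rewrite sqrrN expr0n/= !mul0r expR0 mulr1.
have -> : expR (- (1 + 4 * eps) * (s / 8)) / (4 * M) = kap * c / 4.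
  by rewrite invfM /c (mulrC (4^-1)) mulrA /kap; congr (expR _ * _ / _); lra.
have ee : e * expR (eps ^+ 2 * s / 2) <= 1 / 4.
  by rewrite -expRD (le_trans _ He)// ler_expR; lra.
have cS : c * S <= 1 by rewrite /c mulrC ler_pdivrMr// mul1r.
have H1 := ler_wpM2l kc0 ee; have H2 := ler_wpM2l kc0 cS.
move: H1 H2; rewrite /a1 /a2; lra.
Qed.

End bayes_risk.

(** * Overlaps of random rectangles *)

Section rectangles.
Context {R : realType} {N : nat}.
Implicit Types (a b : R) (I J : {set 'I_N}).

Definition rect_mx a I J : 'M[R]_N :=
  \matrix_(i, j) (a * ((i \in I)%:R * (j \in J)%:R)).

Lemma rect_mx_Theta a n I J :
  #|I| = n -> #|J| = n -> Theta a n N (rect_mx a I J).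
Proof.
move=> cI cJ; exists I, J; split => // i j; rewrite mxE -natrM mulnb.
by case: (_ && _); rewrite ?mulr1 ?mulr0.
Qed.

Lemma mxdot_rect a b I J I' J' :
  mxdot (rect_mx a I J) (rect_mx b I' J') =
  a * b * (#|I :&: I'|%:R * #|J :&: J'|%:R).
Proof.
have cardE (S S' : {set 'I_N}) :
    #|S :&: S'|%:R = \sum_i ((i \in S)%:R * (i \in S')%:R) :> R.
  rewrite -sum1_card natr_sum big_mkcond; apply: eq_bigr => i _.
  by rewrite inE -natrM mulnb; case: ifP.
rewrite !cardE mulr_suml mulr_sumr; apply: eq_bigr => i _.
by rewrite !mulr_sumr; apply: eq_bigr => j _; rewrite !mxE; ring.
Qed.

(** Entries of theta larger than b only increase its scalar product with a
nonnegative constant matrix. *)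
Lemma mxdot_Theta a b n theta : 0 <= a -> Theta b n N theta ->
  a * b * n%:R ^+ 2 <= mxdot (rect_mx a [set: 'I_N]%SET [set: 'I_N]%SET) theta.
Proof.
move=> a0 [I [J [cI cJ IJ]]].
have -> : a * b * n%:R ^+ 2 = mxdot (rect_mx a [set: 'I_N]%SET [set: 'I_N]%SET) (rect_mx b I J).
  by rewrite mxdot_rect !finset.setTI cI cJ expr2.
apply: ler_sum => i _; apply: ler_sum => j _; rewrite !mxE !inE !mulr1.
have [h1 h2] := IJ i j; apply: ler_wpM2l => //.
move: h1 h2; rewrite -natrM mulnb; case: (_ && _).
  by move=> /(_ isT) + _; rewrite mulr1.
by move=> _ /(_ isT) ->; rewrite mulr0.
Qed.

End rectangles.

Section agreement.
Variables n b : nat.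
Implicit Types f g : {ffun 'I_n -> 'I_b}.

Definition agree f g := #|[set i | f i == g i]%SET|.

Lemma agree_le f g : (agree f g <= n)%N.
Proof. by rewrite -[X in (_ <= X)%N](card_ord n) max_card. Qed.

(** Agreements in distinct blocks are independent: the sum over functions of a
product over blocks is the product of the sums over single values, and exactly
one of the b values agrees with f. *)
Lemma sum_expn_agree (R : comNzRingType) (x : R) f :
  (0 < b)%N -> \sum_g x ^+ agree f g = (x + b%:R - 1) ^+ n.
Proof.
move=> b0.
transitivity (\sum_(g : {ffun 'I_n -> 'I_b}) \prod_i (if f i == g i then x else 1)).
  apply: eq_bigr => g _; rewrite -big_mkcond /= prodr_const /agree.
  by congr (_ ^+ _); apply: eq_card => i; rewrite !inE.
rewrite -(bigA_distr_bigA (fun i j => if f i == j then x else 1)).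
rewrite -[n in RHS]card_ord -prodr_const; apply: eq_bigr => i _.
rewrite (bigD1 (f i))//= eqxx (eq_bigr (fun=> 1)); last first.
  by move=> j /negPf; rewrite eq_sym => ->.
rewrite sumr_const (_ : #|_| = b.-1); last first.
  by rewrite (cardC1 (f i)) card_ord.
by case: b b0 => // b' _ /=; rewrite -natr1; ring.
Qed.

Lemma sum_expR_agree (R : realType) (x : R) f : (0 < b)%N ->
  \sum_g expR (x * (agree f g)%:R) <=
  #|{ffun 'I_n -> 'I_b}|%:R * expR (n%:R / b%:R * (expR x - 1)).
Proof.
move=> b0; have bR : 0 < b%:R :> R by rewrite ltr0n.
under eq_bigr do rewrite expRM_natr.
rewrite sum_expn_agree// card_ffun !card_ord natrX.
rewrite -mulrA expRM_natl -exprMn.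
apply: lerXn2r; rewrite ?nnegrE.
- have := expR_gt0 x; have : 1 <= b%:R :> R by rewrite ler1n.
  lra.
- by rewrite mulr_ge0// expR_ge0.
rewrite mulrC -ler_pdivrMr//; apply: le_trans (expR_ge1Dx _).
by rewrite le_eqVlt; apply/orP; left; apply/eqP; field; rewrite gt_eqF.
Qed.

End agreement.

(** Squaring 1 - x / 2 <= exp(- x / 2) bounds exp x by (1 - x / 2)^-2, which is
at most 1 + x + 3 x^2 on [0, 1]. *)
Lemma expR_sub1_le (R : realType) (x : R) :
  0 <= x -> x <= 1 -> expR x - 1 <= x * (1 + 3 * x).
Proof.
move=> x0 x1.
have h : expR (x / 2) * (1 - x / 2) <= 1.
  rewrite -[leRHS]expR0 -(subrr (x / 2)) expRD ler_pM2l ?expR_gt0//.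
  exact: le_trans (expR_ge1Dx _).
have e0 := expR_gt0 (x / 2).
have h2 : expR x * (1 - x / 2) ^+ 2 <= 1.
  rewrite (_ : expR x * _ = (expR (x / 2) * (1 - x / 2)) ^+ 2); last first.
    by rewrite exprMn -expRM_natl; congr (expR _ * _); lra.
  by rewrite expr_le1// mulr_ge0 ?(ltW e0)//; lra.
have y0 : 0 < (1 - x / 2) ^+ 2 by rewrite exprn_gt0//; lra.
rewrite lerBlDr -(ler_pM2r y0); apply: (le_trans h2).
have x2 := mulr_ge0 x0 x0.
have q : 0 <= 9 / 4 - 11 / 4 * x + 3 / 4 * x ^+ 2.
  have := sqr_ge0 (1 - x); nra.
have := mulr_ge0 x2 q; lra.
Qed.

Section block_prior.
Variables n b N : nat.
Hypothesis nbN : (n * b <= N)%N.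

Definition slot (i : 'I_n) (j : 'I_b) : 'I_N :=
  widen_ord nbN (mxvec_index i j).

Lemma slot_inj i j i' j' : slot i j = slot i' j' -> i = i' /\ j = j'.
Proof.
by move=> /(congr1 val) /= /val_inj /enum_rank_inj[-> ->].
Qed.

Definition block_set (f : {ffun 'I_n -> 'I_b}) : {set 'I_N} :=
  [set slot i (f i) | i : 'I_n]%SET.

Lemma card_block_setI f g : #|block_set f :&: block_set g|%SET = agree f g.
Proof.
have -> : (block_set f :&: block_set g =
    (fun i => slot i (f i)) @: [set i | f i == g i])%SET.
  apply/setP => x; rewrite inE; apply/andP/imsetP => [[/imsetP[i _ ->]]|[i]].
    move=> /imsetP[j _ /slot_inj[ij fg]]; exists i => //.
    by rewrite inE fg ij.
  rewrite inE => /eqP fg ->; split; apply/imsetP; exists i => //.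
  by rewrite fg.
by rewrite card_imset// => i j /slot_inj[].
Qed.

Lemma card_block_set f : #|block_set f| = n.
Proof.
rewrite -(finset.setIid (block_set f)) card_block_setI /agree.
by rewrite -[RHS](card_ord n); apply: eq_card => i; rewrite !inE eqxx.
Qed.

Definition block_prior (R : realType) (a : R)
    (fg : {ffun 'I_n -> 'I_b} * {ffun 'I_n -> 'I_b}) : 'M[R]_N :=
  rect_mx a (block_set fg.1) (block_set fg.2).

End block_prior.

Section second_moment.
Context {R : realType}.
Variables (n b N : nat).
Hypotheses (n0 : (0 < n)%N) (b0 : (0 < b)%N).
Variables (a eps : R).
Hypotheses (a0 : 0 < a) (eps0 : 0 < eps) (an : a ^+ 2 * n%:R <= 1).

Let r : R := n%:R / b%:R.
Let mu : R := r * a ^+ 2.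

Let nR : 0 < n%:R :> R. Proof. by rewrite ltr0n. Qed.
Let r0 : 0 < r. Proof. by rewrite divr_gt0// ltr0n. Qed.
Let mu0 : 0 < mu. Proof. by rewrite mulr_gt0// exprn_gt0. Qed.

(** Either a^2 k <= eps and the exponential is linearized up to the factor
1 + 3 eps, or k >= eps n as a^2 n <= 1, and then the crude factor 4 is
compensated by exp(k - eps n) >= 1. *)
Lemma expR_overlap_bound (k : nat) : (k <= n)%N ->
  expR (r * (expR (a ^+ 2 * k%:R) - 1)) <=
  expR (mu * (1 + 3 * eps) * k%:R) + expR (- (eps * n%:R)) * expR ((4 * mu + 1) * k%:R).
Proof.
move=> kn; set x := a ^+ 2 * k%:R.
have kR : k%:R <= n%:R :> R by rewrite ler_nat.
have a2 : 0 < a ^+ 2 by rewrite exprn_gt0.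
have x0 : 0 <= x by rewrite mulr_ge0// ltW.
have x1 : x <= 1 by apply: le_trans an; rewrite ler_pM2l.
have H : r * (expR x - 1) <= mu * k%:R * (1 + 3 * x).
  rewrite /mu -mulrA -mulrA ler_pM2l// mulrA; exact: expR_sub1_le.
have muk : 0 <= mu * k%:R by rewrite mulr_ge0// ltW.
have [xe|ex] := lerP x eps.
  rewrite -[leLHS]addr0 lerD ?mulr_ge0 ?expR_ge0// ler_expR.
  apply: (le_trans H); have := ler_wpM2l muk xe; lra.
rewrite -[leLHS]add0r lerD ?expR_ge0// -expRD ler_expR.
have ek : eps * n%:R <= k%:R.
  rewrite -(ler_pM2l a2) -/x mulrCA; apply: le_trans (ltW ex).
  by rewrite ler_piMr// ltW.
apply: (le_trans H); have := ler_wpM2l muk x1; lra.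
Qed.

Lemma sum_overlap_bound (f g : {ffun 'I_n -> 'I_b}) :
  \sum_(fg : {ffun 'I_n -> 'I_b} * {ffun 'I_n -> 'I_b})
     expR (a ^+ 2 * ((agree f fg.1)%:R * (agree g fg.2)%:R)) <=
  #|{ffun 'I_n -> 'I_b}|%:R ^+ 2 *
  (expR (r * (expR (mu * (1 + 3 * eps)) - 1)) +
   expR (- (eps * n%:R)) * expR (r * (expR (4 * mu + 1) - 1))).
Proof.
set F := #|_|%:R.
rewrite -(pair_bigA _ (fun f' g' => expR (a ^+ 2 * ((agree f f')%:R * (agree g g')%:R))))/=.
apply: (@le_trans _ _ (\sum_f' F * (expR (mu * (1 + 3 * eps) * (agree f f')%:R) +
   expR (- (eps * n%:R)) * expR ((4 * mu + 1) * (agree f f')%:R)))).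
  apply: ler_sum => f' _.
  apply: (@le_trans _ _ (F * expR (r * (expR (a ^+ 2 * (agree f f')%:R) - 1)))).
    under eq_bigr do rewrite mulrA.
    exact: sum_expR_agree.
  by rewrite ler_wpM2l// expR_overlap_bound// agree_le.
rewrite -mulr_sumr expr2 -mulrA ler_wpM2l// big_split/= [leRHS]mulrDr lerD//.
  exact: sum_expR_agree.
rewrite -mulr_sumr [leRHS]mulrCA ler_wpM2l ?expR_ge0//.
exact: sum_expR_agree.
Qed.

Hypothesis nbN : (n * b <= N)%N.

Let s : R := (n%:R ^+ 2 * a / N%:R) ^+ 2.
Let t : R := (r * a) ^+ 2 * (1 + 3 * eps) ^+ 2.

(** The bound M on the second moment is 2 exp(t - s): the first term of
[sum_overlap_bound] contributes exp t, and the second is at most 1. *)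
Lemma minimax_risk_block_lower :
  mu * (1 + 3 * eps) <= eps -> eps <= 1 -> 4 * mu <= 1 ->
  r * expR 2 <= eps * n%:R -> expR (- (eps ^+ 2 * s / 2)) <= 1 / 4 ->
  ((expR (- (1 + 4 * eps) * (s / 8)) / (8 * expR (t - s)))%:E <=
   minimax_risk a n N)%E.
Proof.
move=> mueps eps1 mu1 rn es.
have bR : 0 < b%:R :> R by rewrite ltr0n.
have NR : 0 < N%:R :> R.
  by rewrite ltr0n; apply: leq_trans nbN; rewrite muln_gt0 n0.
have e0 := ltW eps0.
have eps2 : 1 <= 1 + 3 * eps by rewrite lerDl mulr_ge0.
have mueps0 : 0 <= mu * (1 + 3 * eps).
  by rewrite mulr_ge0 ?(ltW mu0)// (le_trans _ eps2).
pose c := n%:R ^+ 2 * a / N%:R ^+ 2.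
pose v := rect_mx c [set: 'I_N]%SET [set: 'I_N]%SET.
have vv : mxdot v v = s.
  by rewrite mxdot_rect finset.setTI cardsT card_ord /c /s; field; rewrite gt_eqF.
have vth k : mxdot v (block_prior nbN a k) = mxdot v v.
  rewrite vv mxdot_rect !finset.setTI !card_block_set /c /s.
  by field; rewrite gt_eqF.
have st : s <= t.
  rewrite /s /t -[leLHS]mulr1; apply: ler_pM; rewrite ?sqr_ge0 ?exprn_ege1//.
  rewrite ler_pXn2r ?nnegrE ?divr_ge0 ?mulr_ge0 ?(ltW a0)// ?(ltW r0)//.
  rewrite (_ : n%:R ^+ 2 * a / N%:R = r * a * ((n * b)%:R / N%:R)); last first.
    by rewrite /r natrM; field; rewrite !gt_eqF.
  by rewrite ler_piMr ?mulr_ge0 ?(ltW a0) ?(ltW r0)// ler_pdivrMr// mul1r ler_nat.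
have K0 : (0 < #|{: {ffun 'I_n -> 'I_b} * {ffun 'I_n -> 'I_b}}|)%N.
  by apply/card_gt0P; exists ([ffun=> Ordinal b0], [ffun=> Ordinal b0]).
rewrite (_ : 8 * _ = 4 * (2 * expR (t - s))); last by ring.
rewrite -vv; apply: (minimax_risk_lower K0 _ vth) => //; last 2 first.
- rewrite vv card_prod natrM -expr2; set F := #|_|%:R.
  have F0 : 0 < F.
    by rewrite ltr0n; apply/card_gt0P; exists [ffun=> Ordinal b0].
  rewrite -(pair_bigA _ (fun k l => expR (mxdot (block_prior nbN a k)
    (block_prior nbN a l) - s)))/=.
  apply: (@le_trans _ _ ((F ^+ 2)^-1 ^+ 2 *
      \sum_(k : {ffun 'I_n -> 'I_b} * {ffun 'I_n -> 'I_b})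
        (F ^+ 2 * (2 * expR (t - s))))); last first.
    rewrite sumr_const card_prod -[_ *+ (_ * _)]mulr_natl natrM -/F.
    by rewrite le_eqVlt; apply/orP; left; apply/eqP; field; rewrite gt_eqF.
  rewrite ler_wpM2l ?sqr_ge0//; apply: ler_sum => -[f g] _.
  under eq_bigr do rewrite expRD mxdot_rect !card_block_setI -expr2.
  rewrite -mulr_suml expRD mulrA mulrA ler_wpM2r ?expR_ge0//.
  apply: (le_trans (sum_overlap_bound f g)).
  rewrite ler_wpM2l ?sqr_ge0// [leRHS]mulr_natl mulr2n lerD//.
    rewrite ler_expR /t (_ : _ ^+ 2 * _ = r * (mu * (1 + 3 * eps) * (1 + 3 * eps))).
      rewrite ler_pM2l//; apply: le_trans (expR_sub1_le _ _) _; last 1 first.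
      - by rewrite ler_wpM2l// lerD2l ler_wpM2l.
      - exact: mueps0.
      - exact: le_trans eps1.
    by rewrite /mu; ring.
  rewrite -expRD; apply: (@le_trans _ _ 1); last first.
    rewrite -[leLHS]expR0 ler_expR mulr_ge0 ?sqr_ge0//.
  rewrite -[leRHS]expR0 ler_expR.
  have : r * (expR (4 * mu + 1) - 1) <= r * expR 2.
    rewrite ler_pM2l//; apply: (@le_trans _ _ (expR (4 * mu + 1))); first by lra.
    by rewrite ler_expR; lra.
  lra.
- by rewrite vv.
- by move=> k; apply: rect_mx_Theta; exact: card_block_set.
- have : 1 <= expR (t - s) by rewrite -[leLHS]expR0 ler_expR subr_ge0.
  rewrite vv; lra.
Qed.

End second_moment.

(** * Asymptotics *)

Lemma near_ln_ge (R : realType) (L : R) : \forall n \near \oo, L <= ln (n%:R : R).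
Proof.
apply: filterS (nbhs_infty_ger (expR L)) => n Ln.
by rewrite -[leLHS]expRK ler_ln// posrE ?expR_gt0// (lt_le_trans (expR_gt0 _) Ln).
Qed.

Lemma near_powR_ge (R : realType) (c L : R) :
  0 < c -> \forall n \near \oo, L <= n%:R `^ c.
Proof.
move=> c0; near=> n.
have n0 : n%:R != 0 :> R.
  by rewrite pnatr_eq0 -lt0n; near: n; exact: nbhs_infty_gt.
rewrite /powR (negbTE n0); apply: le_trans (expR_ge1Dx _).
have : L / c <= ln (n%:R : R) by near: n; exact: near_ln_ge.
rewrite ler_pdivrMr//; lra.
Unshelve. all: by end_near. Qed.

Section sizes.
Context {R : realType}.
Variables (alpha delta eps : R) (n : nat).
Hypothesis sum_le : alpha + delta <= 1 / 2.
Hypothesis n0 : (0 < n)%N.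
Hypotheses (eps0 : 0 < eps) (eps1 : eps <= 1).

Let h : R := n%:R.
Let X : R := h `^ delta.
Let Y : R := h `^ alpha.
Let A : R := h `^ (- (1 - alpha - delta)).
Let N := ambient_size alpha n.
Let b := (N %/ n)%N.

Hypothesis n_large : 1 <= 4 * (1 + delta) * alpha * ln h.
Hypothesis Y_large : expR 2 + 4 <= eps * (Y - 2).
Hypothesis X_large : 6 <= eps ^+ 2 * X ^+ 2.
Hypothesis X_large_ln : ln 8 <= eps * X ^+ 2.

Let h1 : 1 <= h. Proof. by rewrite ler1n. Qed.
Let h0 : 0 < h. Proof. exact: lt_le_trans h1. Qed.
Let X0 : 0 < X. Proof. exact: powR_gt0. Qed.
Let Y0 : 0 < Y. Proof. exact: powR_gt0. Qed.
Let A0 : 0 < A. Proof. exact: powR_gt0. Qed.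

Let powRDh r t : h `^ (r + t) = h `^ r * h `^ t.
Proof. by apply: powRD; apply/implyP => _; rewrite gt_eqF. Qed.

Let powRh1 : h `^ 1 = h. Proof. by rewrite powRr1// ltW. Qed.

Lemma scaled_signal_le1 : A ^+ 2 * h <= 1.
Proof.
have -> : A ^+ 2 * h = h `^ (- (1 - alpha - delta) + - (1 - alpha - delta) + 1).
  by rewrite !powRDh powRh1 expr2.
by rewrite -[leRHS](powRr0 h) ler_powR//; move: sum_le; lra.
Qed.

(** In this regime A^2 n <= 1, whereas the square of the second argument of the
minimum, times n, grows like ln n. *)
Lemma Astar_eq : Astar delta alpha n = A.
Proof.
rewrite /Astar -/h -/A; apply: min_idPl.
rewrite -[leLHS](ger0_norm (ltW A0)) -sqrtr_sqr ler_sqrt; last first.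
  by rewrite divr_ge0 ?(ltW h0)// (le_trans _ n_large).
by rewrite ler_pdivlMr// (le_trans scaled_signal_le1).
Qed.

Lemma signal_scale : h * A = X * Y.
Proof.
rewrite -[X in X * _]powRh1 /A /X /Y -!powRDh.
by congr (_ `^ _); lra.
Qed.

Lemma ambient_size_bounds : N%:R <= h * Y < N%:R + 1.
Proof.
have -> : h * Y = h `^ (1 + alpha) by rewrite powRDh powRh1.
by rewrite natr1; apply: Num.Theory.truncn_itv; exact: powR_ge0.
Qed.

Let hN : N%:R <= h * Y. Proof. by have /andP[] := ambient_size_bounds. Qed.

Let Y_gt2 : 0 < Y - 2.
Proof.
have e2 := expR_gt0 (2 : R).
by rewrite -(pmulr_rgt0 _ eps0) (lt_le_trans _ Y_large)// addr_gt0.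
Qed.

Let eY : 4 <= eps * (Y - 2).
Proof. by apply: le_trans Y_large; rewrite lerDr expR_ge0. Qed.

Let N_ge : h * (Y - 1) <= N%:R.
Proof.
have /andP[_ hY] := ambient_size_bounds.
by rewrite mulrBr mulr1; move: h1 hY; lra.
Qed.

Let N0 : 0 < N%:R :> R.
Proof. by apply: lt_le_trans N_ge; rewrite mulr_gt0//; move: Y_gt2; lra. Qed.

(** Rounding costs at most 1 in N and at most 1 in the quotient by n. *)
Lemma block_size_ge : Y - 2 <= b%:R.
Proof.
have Nb : N%:R <= h * (b%:R + 1) :> R.
  by rewrite natr1 -natrM ler_nat mulnC ltnW// ltn_ceil.
by have := le_trans N_ge Nb; rewrite ler_pM2l//; lra.
Qed.

Let b0R : 0 < b%:R :> R. Proof. exact: lt_le_trans block_size_ge. Qed.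

Let m : R := h ^+ 2 * A / N%:R.

Let hA : h ^+ 2 * A = X * (h * Y).
Proof. by rewrite expr2 -mulrA signal_scale mulrCA. Qed.

Lemma sum_signal_ge : X <= m.
Proof. by rewrite /m ler_pdivlMr// hA ler_pM2l. Qed.

Lemma sum_signal_le : m <= (1 + eps) * X.
Proof.
rewrite /m ler_pdivrMr// hA mulrAC mulrC ler_pM2r//.
have e1 : 0 <= 1 + eps by rewrite addr_ge0// ltW.
apply: le_trans (ler_wpM2l e1 N_ge); rewrite mulrCA ler_pM2l//.
by move: eY eps1 eps0; lra.
Qed.

Lemma block_signal_le : h / b%:R * A <= (1 + eps) * X.
Proof.
rewrite mulrAC ler_pdivrMr// signal_scale mulrAC mulrC ler_pM2r//.
have e1 : 0 <= 1 + eps by rewrite addr_ge0// ltW.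
apply: le_trans (ler_wpM2l e1 block_size_ge).
by move: eY eps1 eps0; lra.
Qed.

Let s : R := m ^+ 2.

Lemma ambient_risk_upper : (minimax_risk A n N <= (2 * expR (- (s / 8)))%:E)%E.
Proof.
pose c := h ^+ 2 * A / N%:R ^+ 2.
have vv : mxdot (rect_mx c [set: 'I_N]%SET [set: 'I_N]%SET)
    (rect_mx c [set: 'I_N]%SET [set: 'I_N]%SET) = s.
  rewrite mxdot_rect finset.setTI cardsT card_ord /c /s /m.
  by field; rewrite gt_eqF.
rewrite -vv; apply: minimax_risk_upper => theta.
have c0 : 0 <= c by rewrite /c !mulr_ge0 ?invr_ge0 ?exprn_ge0 ?(ltW h0) ?(ltW A0).
rewrite vv => /(mxdot_Theta c0); apply: le_trans.
by rewrite le_eqVlt; apply/orP; left; apply/eqP; rewrite /s /m /c; field;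
  rewrite gt_eqF.
Qed.

Let t : R := (h / b%:R * A) ^+ 2 * (1 + 3 * eps) ^+ 2.

Lemma ambient_risk_lower :
  ((expR (- (1 + 4 * eps) * (s / 8)) / (8 * expR (t - s)))%:E <=
   minimax_risk A n N)%E.
Proof.
have mu_le : h / b%:R * A ^+ 2 <= (Y - 2)^-1.
  rewrite mulrAC -(mulrC _ h); apply: (@le_trans _ _ (b%:R^-1)).
    by rewrite ler_piMl ?invr_ge0 ?(ltW b0R)// scaled_signal_le1.
  by rewrite lef_pV2 ?posrE// block_size_ge.
have Vle : 4 * (Y - 2)^-1 <= eps by rewrite ler_pdivrMr.
have b0 : (0 < b)%N by rewrite -(ltr0n R).
have V0 : 0 <= (Y - 2)^-1 by rewrite invr_ge0 ltW.
apply: minimax_risk_block_lower => //.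
- exact: scaled_signal_le1.
- by rewrite mulnC leq_trunc_div.
- apply: (le_trans _ Vle); rewrite (mulrC 4); apply: ler_pM => //.
  + by rewrite mulr_ge0 ?sqr_ge0 ?divr_ge0 ?(ltW h0) ?(ltW b0R).
  + by rewrite addr_ge0// mulr_ge0// ltW.
  + by move: eps1; lra.
- by apply: le_trans eps1; apply: (le_trans _ Vle); rewrite ler_pM2l.
- rewrite mulrAC ler_pdivrMr// mulrAC (mulrC h) ler_pM2r//.
  apply: (le_trans _ (ler_wpM2l (ltW eps0) block_size_ge)).
  by apply: le_trans Y_large; rewrite lerDl.
have e6 : 3 <= eps ^+ 2 * s / 2.
  have : eps ^+ 2 * X ^+ 2 <= eps ^+ 2 * s.
    rewrite ler_pM2l ?exprn_gt0// /s ler_pXn2r ?nnegrE ?(ltW X0)//.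
      exact: sum_signal_ge.
    exact: le_trans (ltW X0) sum_signal_ge.
  by move: X_large; lra.
rewrite expRN mul1r lef_pV2 ?posrE ?expR_gt0//.
by apply: le_trans (expR_ge1Dx _); move: e6; rewrite /s /m /h; lra.
Qed.

(** The constant 67 collects the relative errors, all linear in eps because
eps <= 1: 19 / 8 from (1 + 4 eps) (1 + eps)^2 / 8, 63 from
(1 + eps)^2 (1 + 3 eps)^2 - 1, and 1 from the logarithm of a constant. *)
Lemma log_risk_near : `|ln (risk alpha n (Astar delta alpha n)) / X ^+ 2 + 1 / 8|
  <= 67 * eps.
Proof.
rewrite /risk Astar_eq -/N.
have lo := ambient_risk_lower; have up := ambient_risk_upper.
have Mfin : minimax_risk A n N \is a fin_num.
  rewrite fin_numE; apply/andP; split; apply/eqP => E.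
    by move: lo; rewrite E.
  by move: up; rewrite E.
move: lo up; rewrite -(fineK Mfin) !lee_fin.
set r := fine _ => lo up.
have X2 : 0 < X ^+ 2 by rewrite exprn_gt0.
have d0 : 0 < 8 * expR (t - s) by rewrite mulr_gt0// expR_gt0.
have lo0 : 0 < expR (- (1 + 4 * eps) * (s / 8)) / (8 * expR (t - s)).
  by rewrite divr_gt0// expR_gt0.
have r0 : 0 < r by exact: lt_le_trans lo.
have m0 : 0 <= m by exact: le_trans (ltW X0) sum_signal_ge.
have eX : 0 <= (1 + eps) * X by exact: le_trans m0 sum_signal_le.
have bA : 0 <= h / b%:R * A.
  by rewrite !mulr_ge0 ?invr_ge0 ?(ltW h0) ?(ltW A0) ?(ltW b0R).
have sX : X ^+ 2 <= s.
  by rewrite ler_pXn2r ?nnegrE ?(ltW X0)// sum_signal_ge.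
have sX2 : s <= (1 + eps) ^+ 2 * X ^+ 2.
  by rewrite -exprMn ler_pXn2r ?nnegrE// sum_signal_le.
have tX : t <= (1 + eps) ^+ 2 * (1 + 3 * eps) ^+ 2 * X ^+ 2.
  rewrite /t [leRHS]mulrAC ler_pM2r ?exprn_gt0//; last by move: eps0; lra.
  by rewrite -exprMn ler_pXn2r ?nnegrE// block_signal_le.
have {}up : ln r <= ln 2 - s / 8.
  rewrite -[X in _ + X]expRK -lnM ?posrE ?expR_gt0//.
  by rewrite ler_ln ?posrE ?mulr_gt0 ?expR_gt0.
have {}lo : - (1 + 4 * eps) * (s / 8) - (ln 8 + (t - s)) <= ln r.
  rewrite -[X in X - _ <= _]expRK -[t - s]expRK -lnM ?posrE ?expR_gt0//.
  by rewrite -ln_div ?posrE ?expR_gt0// ler_ln ?posrE.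
have ln2 : ln 2 <= ln 8 :> R by rewrite ler_ln ?posrE// ler_nat.
rewrite (_ : _ + 1 / 8 = (ln r + X ^+ 2 / 8) / X ^+ 2); last first.
  by field; rewrite gt_eqF.
rewrite ler_norml ler_pdivlMr// ler_pdivrMr//; apply/andP; split; last first.
  have := mulr_ge0 (ltW eps0) (ltW X2).
  by move: X_large_ln; lra.
have e0 := ltW eps0.
have p1 : (1 + 4 * eps) * (1 + eps) ^+ 2 <= 1 + 19 * eps.
  have := mulr_ge0 e0 e0; have := eps1; nra.
have p2 : (1 + eps) ^+ 2 * (1 + 3 * eps) ^+ 2 <= 1 + 63 * eps.
  have := mulr_ge0 e0 e0; have := eps1; nra.
have q1 := ler_wpM2r (ltW X2) p1.
have q2 := ler_wpM2r (ltW X2) p2.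
have e4 : 0 <= 1 + 4 * eps by move: eps0; lra.
have q3 := ler_wpM2l e4 sX2.
by move: X_large_ln; lra.
Qed.

End sizes.

Theorem theorem2p1 (R : realType) (alpha delta : R)
    (halpha : 0 < alpha) (hdelta : 0 < delta)
    (hsum : alpha + delta <= 1 / 2) :
  ln (risk alpha n (Astar delta alpha n)) / n%:R `^ (2 * delta)
    @[n --> \oo] --> (- (1 / 8) : R).
Proof.
apply/cvgrPdist_le => e e0.
pose eps := Num.min 1 (e / 67).
have eps0 : 0 < eps by rewrite lt_min ltr01 divr_gt0.
have eps1 : eps <= 1 by rewrite ge_min lexx.
have epse : 67 * eps <= e.
  by rewrite mulrC -ler_pdivlMr// ge_min lexx orbT.
near=> n.
have powX : n%:R `^ (2 * delta) = (n%:R `^ delta) ^+ 2 :> R.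
  by rewrite mulrC powRrM powR_mulrn// powR_ge0.
rewrite -normrN opprB opprK powX; apply: le_trans epse.
apply: log_risk_near => //.
- by near: n; exact: nbhs_infty_gt.
- have c0 : 0 < 4 * (1 + delta) * alpha.
    by rewrite !mulr_gt0// addr_gt0.
  rewrite mulrC -ler_pdivrMr//; near: n; exact: near_ln_ge.
- rewrite mulrC -ler_pdivrMr// lerBrDr; near: n; exact: near_powR_ge.
- rewrite mulrC -ler_pdivrMr ?exprn_gt0// -powX; near: n.
  by apply: near_powR_ge; rewrite mulr_gt0.
- rewrite mulrC -ler_pdivrMr// -powX; near: n.
  by apply: near_powR_ge; rewrite mulr_gt0.
Unshelve. all: by end_near. Qed.
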